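(* Let $k\geq 1$ and $n\geq k$ be integers. Then $$\mathrm{sat}(n,\mathcal{D}_k)=\binom{n-k+1}{2}+(k-1)(2n-k).$$
   Context: All digraphs are finite and strict (no loops, no parallel arcs; a pair of opposite arcs $(u,v),(v,u)$ is allowed). $V(D)$ and $A(D)$ denote the vertex set and arc set of $D$. The complement digraph $D^c$ has vertex set $V(D)$ and its arcs are all ordered pairs $(u,v)$ of distinct vertices with $(u,v)\notin A(D)$. For $e\in A(D^c)$, $D+e$ is the digraph obtained from $D$ by adding the arc $e$. A digraph is strongly connected if for every pair of distinct vertices $u,v$ there are both a directed path from $u$ to $v$ and one from $v$ to $u$. A separator of $D$ is a set $S\subseteq V(D)$ such that $D-S$ is not strongly connected or is trivial (a single vertex). The vertex-strong connectivity $\kappa(D)$ is the minimum cardinality of a separator of $D$. $D$ is $k$-strongly connected if $\kappa(D)\ge k$ (in particular, a $k$-strongly connected digraph has at least $k+1$ vertices). $\mathcal{D}_k$ is the family of all $k$-strongly connected digraphs. A digraph $D$ is $\mathcal{D}_k$-saturated if it contains no member of $\mathcal{D}_k$ as a subdigraph, but for every arc $e\in A(D^c)$ the digraph $D+e$ contains a member of $\mathcal{D}_k$ as a subdigraph (in particular every complete digraph of order at most $k$ is $\mathcal{D}_k$-saturated). The saturation number $\mathrm{sat}(n,\mathcal{D}_k)$ is the minimum number of arcs among all $n$-vertex $\mathcal{D}_k$-saturated digraphs. Convention: $\binom{1}{2}=0$. *)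

(* Defs.v *)
From mathcomp Require Import all_boot.

Set Implicit Arguments.
Unset Strict Implicit.
Unset Printing Implicit Defensive.

Definition all_arcs (T : finType) (V : {set T}) : {set T * T} :=
  [set e | [&& e.1 \in V, e.2 \in V & e.1 != e.2]].

(* The vertex set is a subset of an ambient finite type, so that D, its
   subdigraphs, D - S, D^c and D + e all live in the same type. *)
Record digraph (T : finType) := Digraph {
  vertices : {set T};
  arcs : {set T * T};
  arcs_wf : arcs \subset all_arcs vertices
}.

Lemma mk_digraph_subproof (T : finType) (V : {set T}) (A : {set T * T}) :
  A :&: all_arcs V \subset all_arcs V.
Proof. exact: subsetIr. Qed.

(* Pairs of A that are loops or leave V are discarded. *)
Definition mk_digraph (T : finType) (V : {set T}) (A : {set T * T}) :
  digraph T := Digraph (mk_digraph_subproof V A).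

Section Digraphs.

Variable T : finType.
Implicit Types (D H : digraph T) (S : {set T}) (e : T * T).

Definition subdigraph H D : bool :=
  (vertices H \subset vertices D) && (arcs H \subset arcs D).

Definition complement D : digraph T :=
  mk_digraph (vertices D) (~: arcs D).

(* Used only for e \in arcs (complement D), in which case nothing is
   discarded by mk_digraph. *)
Definition add_arc D e : digraph T :=
  mk_digraph (vertices D) (e |: arcs D).

Definition del_vertices D S : digraph T :=
  mk_digraph (vertices D :\: S) (arcs D).

Definition arc_rel D : rel T := fun u v => (u, v) \in arcs D.

Definition strongly_connected D : bool :=
  [forall u in vertices D, forall v in vertices D,
     (u != v) ==> connect (arc_rel D) u v].

Definition trivial_digraph D : bool := #|vertices D| == 1.

Definition separator D S : bool :=
  (S \subset vertices D) &&
  (~~ strongly_connected (del_vertices D S)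
   || trivial_digraph (del_vertices D S)).

(* If D has a vertex, deleting all its vertices but one gives a separator, of
   size less than #|vertices D|, so the default value of the minimum plays no
   role. The digraph without vertices has no separator; it gets the value 0. *)
Definition kappa D : nat :=
  \big[minn/#|vertices D|]_(S : {set T} | separator D S) #|S|.

End Digraphs.

(* Families are meant to be closed under isomorphism, so that containing a
   copy of a member is the same as having a subdigraph in the family. *)
Definition digraph_family := forall T : finType, digraph T -> bool.

Definition k_strongly_connected (k : nat) : digraph_family :=
  fun T D => k <= kappa D.

Definition contains_member (F : digraph_family) (T : finType)
    (D : digraph T) : Prop :=
  exists2 H : digraph T, subdigraph H D & F T H.

Definition saturated (F : digraph_family) (T : finType)
    (D : digraph T) : Prop :=
  ~ contains_member F D /\
  forall e : T * T, e \in arcs (complement D) -> contains_member F (add_arc D e).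

(* sat(n, F) = m: the minimum exists and is m. *)
Definition is_sat (n : nat) (F : digraph_family) (m : nat) : Prop :=
  (exists (T : finType) (D : digraph T),
     [/\ #|vertices D| = n, saturated F D & #|arcs D| = m]) /\
  (forall (T : finType) (D : digraph T),
     #|vertices D| = n -> saturated F D -> m <= #|arcs D|).

(* Main.v *)
(** Call a missing arc of a digraph D without k-strong subdigraph completing if
    adding it creates one.  By induction on the order n of D, there are at most
    C(n-k+1, 2) completing arcs.  If n > k, then D is not k-strong, so its
    vertices split into S, A, B with |S| = k-1, A and B nonempty, and no arc from
    B to A.  Unless e goes from B to A, a k-strong subdigraph of D+e cannot meet
    both A and B, hence e is completing for D-B or for D-A.  This gives at most
    |A||B| + C(|A|, 2) + C(|B|, 2) = C(|A|+|B|, 2) completing arcs.  In a saturated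
    digraph all missing arcs are completing; the bound is attained by the join of
    a complete digraph on k-1 vertices and a transitive tournament. *)
Require Import Defs.
From mathcomp Require Import all_boot.
From mathcomp Require Import zify.

Set Implicit Arguments.
Unset Strict Implicit.
Unset Printing Implicit Defensive.

(** * Auxiliary facts on minima, reachability, cardinalities and binomials *)

Lemma bigminn_le (I : eqType) (s : seq I) (P : pred I) (F : I -> nat) m x :
  x \in s -> P x -> \big[minn/m]_(i <- s | P i) F i <= F x.
Proof.
elim: s => // y s IHs; rewrite inE big_cons => /orP[/eqP <- -> | xs Px].
  exact: geq_minl.
case: (P y); last exact: IHs.
by rewrite geq_min IHs ?orbT.
Qed.

Lemma connect_closed (T : finType) (e : rel T) (B : {set T}) x y :
  (forall u v, e u v -> u \in B -> v \in B) ->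
  connect e x y -> x \in B -> y \in B.
Proof.
move=> clB /connectP[p]; elim: p x => [|z p IHp] x /=; first by move=> _ ->.
by case/andP=> exz /IHp{}IHp /IHp{}IHp xB; apply: IHp; apply: clB xB.
Qed.

Lemma subset_of_size (T : finType) (S W : {set T}) m :
  S \subset W -> #|S| <= m <= #|W| ->
  exists X : {set T}, [/\ S \subset X, X \subset W & #|X| = m].
Proof.
move=> sSW /andP[]; elim: m => [|m IHm] leS leW.
  by exists S; split=> //; lia.
move: leS; rewrite leq_eqVlt => /orP[/eqP eqS | leS]; first by exists S.
have [|X [sSX sXW cX]] := IHm leS; first exact: ltnW.
have /properP[_ [x xW xX]] : X \proper W by rewrite properEcard sXW cX.
exists (x |: X); split; last by rewrite cardsU1 xX cX.
  exact: subset_trans sSX (subsetUr _ _).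
by rewrite subUset sub1set xW.
Qed.

Lemma binD2 a b : 'C(a + b, 2) = a * b + 'C(a, 2) + 'C(b, 2).
Proof. by elim: a => [|a IHa]; rewrite ?bin0n // addSn !binS !bin1 IHa; lia. Qed.

(** Truncated subtraction kills the terms with [i <= m]; the others are 1, 2, ..., [n - m - 1]. *)
Lemma sum_subn_bin2 m n : \sum_(i < n) (i - m) = 'C(n - m, 2).
Proof.
elim: n => [|n IHn]; first by rewrite big_ord0.
rewrite big_ord_recr /= IHn; have [le_mn | lt_nm] := leqP m n.
  by rewrite subSn // binS bin1.
by have [-> ->] : n - m = 0 /\ n.+1 - m = 0 by lia.
Qed.

Lemma card_ord_interval n m p :
  p <= n -> #|[set i : 'I_n | m <= i < p]| = p - m.
Proof.
move=> le_pn; rewrite -sum1dep_card -(big_ord_widen_cond _ (leq m) (fun=> 1)) //.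
have := big_geq_mkord m p xpredT (fun=> 1) => /= <-.
by rewrite sum_nat_const_nat muln1.
Qed.

Lemma card_all_arcs (T : finType) (V : {set T}) :
  #|all_arcs V| = #|V| * (#|V| - 1).
Proof.
have -> : all_arcs V = setX V V :\: [set (x, x) | x in V].
  apply/setP=> -[x y]; rewrite !inE /= andbA andbC.
  case xyV: ((x \in V) && (y \in V)); rewrite ?andbF // !andbT; congr (~~ _).
  apply/eqP/imsetP=> [<- | [z _ [-> ->]]] //.
  by exists x; case/andP: xyV.
rewrite cardsD (setIidPr _) ?cardsX ?card_imset; first by rewrite mulnBr muln1.
  by move=> x y [].
by apply/subsetP=> _ /imsetP[x xV ->]; rewrite inE /= xV.
Qed.

(** * Connectivity and vertex cuts *)

Section Connectivity.

Variable T : finType.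
Implicit Types (D H : digraph T) (A B S X W : {set T}) (e : T * T).

Lemma arcsP D e : e \in arcs D ->
  [/\ e.1 \in vertices D, e.2 \in vertices D & e.1 != e.2].
Proof. by move/(subsetP (arcs_wf D)); rewrite inE => /and3P. Qed.

Lemma digraph_eta D : mk_digraph (vertices D) (arcs D) = D.
Proof.
case: D => V E wfE; rewrite /mk_digraph /=; move: (mk_digraph_subproof _ _).
by rewrite (setIidPl wfE) => wfE'; rewrite (bool_irrelevance wfE' wfE).
Qed.

Lemma card_complement D :
  #|arcs D| + #|arcs (complement D)| = #|vertices D| * (#|vertices D| - 1).
Proof.
rewrite -card_all_arcs -(cardsID (arcs D) (all_arcs _)) (setIidPr (arcs_wf D)).
by rewrite /= setIC -setDE.
Qed.

Lemma kappa_le_separator D S : separator D S -> kappa D <= #|S|.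
Proof. by move=> sepS; apply: bigminn_le; rewrite ?mem_index_enum. Qed.

(** The first hypothesis covers the default value [#|vertices D|] of the minimum. *)
Lemma leq_kappa k D : k <= #|vertices D| ->
  (forall S, separator D S -> k <= #|S|) -> k <= kappa D.
Proof.
move=> leV leS; apply: (big_ind (leq k)) => // x y lex ley.
by rewrite leq_min lex.
Qed.

(** Deleting all vertices but one leaves a trivial digraph. Positivity excludes the empty digraph,
    where [kappa] takes its default value 0. *)
Lemma kappa_lt_order D : 0 < kappa D -> kappa D < #|vertices D|.
Proof.
have [V0 | [x xV]] := set_0Vmem (vertices D).
  rewrite /kappa big_pred0 ?V0 ?cards0 // => S; rewrite /separator /= V0 subset0.
  case: eqP => //= ->; rewrite /trivial_digraph /= V0 set0D cards0 orbF.
  apply/negbTE; rewrite negbK; apply/forall_inP=> u.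
  by rewrite /= V0 set0D inE.
move=> _; rewrite (cardsD1 x) xV ltnS; apply: kappa_le_separator.
rewrite /separator subD1set /trivial_digraph /= setDDr setDv set0U.
by rewrite (setIidPr _) ?sub1set // cards1 orbT.
Qed.

(** Once the vertices outside [A :|: B] are deleted, the set [B] is closed under out-neighbours, so
    no path leads from [B] to [A]. The sets may exceed [vertices H], so a cut of a digraph applies
    directly to its subdigraphs. *)
Lemma kappa_le_cut H A B : [disjoint A & B] ->
  vertices H :&: A != set0 -> vertices H :&: B != set0 ->
  (forall u v, u \in B -> v \in A -> (u, v) \notin arcs H) ->
  kappa H <= #|vertices H :\: (A :|: B)|.
Proof.
move=> disAB /set0Pn[a /setIP[aH aA]] /set0Pn[b /setIP[bH bB]] noBA.
apply: kappa_le_separator; rewrite /separator subsetDl; apply/orP; left.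
apply/negP=> /forall_inP/(_ b); rewrite !inE bB bH !orbT /= => /(_ isT).
move=> /forall_inP/(_ a); rewrite !inE aA aH /= => /(_ isT)/implyP.
have aNB : a \notin B by rewrite (disjointFr disAB).
have nba : b != a by apply: contraNneq aNB => <-.
move/(_ nba)=> /(@connect_closed _ _ B) abB.
apply: (negP aNB); apply: abB => // u v; rewrite /arc_rel !inE /=.
case/andP=> uvH /and3P[_ /andP[vAB vH] _] uB.
move: vAB; rewrite vH andbT negbK => /orP[vA | //].
by case/negP: (noBA _ _ uB vA).
Qed.

(** Some separator [S] has fewer than [k] vertices and leaves [u], [v] with [v] unreachable from
    [u]. It is enlarged, away from [u] and [v], to a set [X] of exactly [k - 1] vertices; [B] is
    what [u] reaches in [D - S], outside [X], and [A] is the rest. The size equation says that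
    [k - 1] vertices lie outside [A] and [B]. *)
Lemma small_kappa_cut k D : 0 < k -> k < #|vertices D| -> kappa D < k ->
  exists A B, [/\ (A != set0) && (B != set0), [disjoint A & B],
    (A \subset vertices D) && (B \subset vertices D),
    #|A| + #|B| + k = #|vertices D|.+1 &
    forall u v, u \in B -> v \in A -> (u, v) \notin arcs D].
Proof.
set V := vertices D => k_gt0 ltkV ltDk.
have /existsP[S /andP[/andP[sSV sepS] ltSk]] :
    [exists S, separator D S && (#|S| < k)].
  apply: contraTT ltDk; rewrite -leqNgt => /existsPn noS.
  apply: leq_kappa => [|S sepS]; first exact: ltnW.
  by rewrite leqNgt; have := noS S; rewrite sepS.
have{sepS} : ~~ strongly_connected (del_vertices D S).
  (* A single remaining vertex would give [#|V| = #|S| + 1 <= k]. *)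
  case/orP: sepS => //; rewrite /trivial_digraph /= -/V cardsD (setIidPr sSV).
  by move/eqP; lia.
case/forall_inPn=> u uVS /forall_inPn[v vVS]; rewrite negb_imply.
case/andP=> neq_uv not_uv.
pose B0 := [set w in V :\: S | connect (arc_rel (del_vertices D S)) u w].
have [X [sSX sX cX]] : exists X : {set T},
    [/\ S \subset X, X \subset V :\: [set u; v] & #|X| = k - 1].
  apply: subset_of_size.
    apply/subsetP=> w wS; rewrite !inE (subsetP sSV) // andbT.
    by apply/norP; split; apply: contraTneq wS => ->; [case/setDP: uVS|case/setDP: vVS].
  have /subset_leq_card : [set u; v] \subset V.
    by rewrite subUset !sub1set; case/setDP: uVS => ->; case/setDP: vVS => ->.
  rewrite cardsD; have : #|[set u; v]| = 2 by rewrite cards2 neq_uv.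
  have := subset_leq_card (subsetIr V [set u; v]); lia.
have sXV : X \subset V := subset_trans sX (subsetDl _ _).
have uX : u \notin X by apply/negP=> /(subsetP sX); rewrite !inE eqxx.
have vX : v \notin X by apply/negP=> /(subsetP sX); rewrite !inE eqxx orbT.
have uV : u \in V by case/setDP: uVS.
have vV : v \in V by case/setDP: vVS.
have uB0 : u \in B0 by rewrite inE uVS connect0.
have vB0 : v \notin B0 by rewrite inE vVS.
exists ((V :\: X) :\: B0), ((V :\: X) :&: B0); split.
- apply/andP; split.
    by apply/set0Pn; exists v; rewrite in_setD vB0 in_setD vX.
  by apply/set0Pn; exists u; rewrite in_setI uB0 in_setD uX uV.
- rewrite -setI_eq0; apply/eqP/setP=> w; rewrite in_setI in_setD in_setI in_set0.
  by case: (w \in B0); rewrite ?andbF.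
- by rewrite !subDset; apply/andP; split; apply/subsetP=> w;
  rewrite !inE; case: (w \in V); rewrite ?andbF ?orbT.
- rewrite [X in X + k]addnC cardsID cardsD (setIidPr sXV) cX.
  by move: #|V| ltkV k_gt0 => c; clear; lia.
move=> x y /setIP[_ xB] /setDP[/setDP[yV yX] yB].
have yS : y \notin S by apply: contraNN yX => /(subsetP sSX).
apply: contraNN yB => xyD; rewrite in_set in_setD yS yV /=.
move: xB; rewrite inE => /andP[xVS ux]; apply: connect_trans ux _.
apply: connect1; rewrite /arc_rel in_setI xyD inE /= xVS in_setD yS yV /=.
by have [] := arcsP xyD.
Qed.

(** Candidates range over pairs of sets, a finite type, so the property is boolean and can define a
    finite set of arcs. *)
Definition has_k_strong k D :=
  [exists p : {set T} * {set T * T},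
     subdigraph (mk_digraph p.1 p.2) D && (k <= kappa (mk_digraph p.1 p.2))].

Lemma has_k_strongP k D :
  reflect (contains_member (k_strongly_connected k) D) (has_k_strong k D).
Proof.
apply: (iffP existsP) => [[p /andP[sD kD]] | [H sD kD]].
  by exists (mk_digraph p.1 p.2).
by exists (vertices H, arcs H); rewrite /= digraph_eta sD.
Qed.

(** * Upper bound on the number of completing arcs *)

Definition completing_arcs k D :=
  [set e in arcs (complement D) | has_k_strong k (add_arc D e)].

(** As [D] has no k-strong subdigraph, [H] must use [e]. Since [H] avoids [X], both ends of [e] and
    all arcs of [H] survive the deletion of [X]. *)
Lemma completing_del k D H X e : ~~ has_k_strong k D ->
  e \in arcs (complement D) -> subdigraph H (add_arc D e) -> k <= kappa H ->
  vertices H :&: X = set0 -> e \in completing_arcs k (del_vertices D X).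
Proof.
move=> noD eD /andP[/= sHV sHA] kH HX.
have HNX x : x \in vertices H -> x \notin X.
  by move=> xH; apply/negP=> xX; move/setP/(_ x): HX; rewrite !inE xH xX.
have eH : e \in arcs H.
  apply: contraNT noD => eH; apply/has_k_strongP; exists H => //.
  rewrite /subdigraph sHV; apply/subsetP=> f fH.
  move: (subsetP sHA _ fH); rewrite !inE => /andP[/orP[/eqP ef|//] _].
  by rewrite -ef fH in eH.
have [e1H e2H ne] := arcsP eH.
have e1X := HNX _ e1H; have e2X := HNX _ e2H.
rewrite inE; apply/andP; split.
  move: eD; rewrite !inE /= => /andP[eD /and3P[-> -> ->]].
  by rewrite e1X e2X (negPf eD).
apply/has_k_strongP; exists H => //; apply/andP; split.
  by apply/subsetP=> x xH; rewrite !inE HNX // (subsetP sHV).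
apply/subsetP=> f fH; have [f1H f2H nf] := arcsP fH.
move: (subsetP sHA _ fH); rewrite !inE /= !HNX // nf.
by case/andP=> /orP[-> | ->] /and3P[-> ->]; rewrite ?orbT.
Qed.

Lemma has_k_strong_del k D X :
  ~~ has_k_strong k D -> ~~ has_k_strong k (del_vertices D X).
Proof.
apply: contraNN => /has_k_strongP[H /andP[sV sA] kH].
apply/has_k_strongP; exists H => //; apply/andP; split.
  exact: subset_trans sV (subsetDl _ _).
exact: subset_trans sA (subsetIl _ _).
Qed.

Lemma card_completing_arcs k D : 0 < k -> ~~ has_k_strong k D ->
  #|completing_arcs k D| <= 'C(#|vertices D| - k + 1, 2).
Proof.
move=> k_gt0; have [n] := ubnP #|vertices D|.
elim: n D => // n IHn D ltDn noD.
have [leVk | ltkV] := leqP #|vertices D| k.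
  (* A k-strong digraph has more than [k] vertices, so adding an arc cannot create one here. *)
  rewrite (_ : completing_arcs k D = set0) ?cards0 //.
  apply/setP=> e; rewrite !inE; apply/negP=> /andP[_ /has_k_strongP[H]].
  case/andP=> /subset_leq_card /= sHV _; rewrite /k_strongly_connected => kH.
  by have := kappa_lt_order (leq_trans k_gt0 kH); lia.
have ltDk : kappa D < k.
  rewrite ltnNge; apply: contraNN noD => kD; apply/has_k_strongP.
  by exists D; rewrite /subdigraph ?subxx.
have [A [B [/andP[A0 B0] disAB /andP[sA sB] cAB noBA]]] := small_kappa_cut k_gt0 ltkV ltDk.
have sub : completing_arcs k D \subset setX B A :|:
    (completing_arcs k (del_vertices D A) :|: completing_arcs k (del_vertices D B)).
  apply/subsetP=> e; rewrite inE => /andP[eD /has_k_strongP[H sH kH]].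
  case eBA: (e \in setX B A); first by rewrite inE eBA.
  rewrite !in_setU eBA /=.
  have [HA | HA] := eqVneq (vertices H :&: A) set0.
    by rewrite (completing_del noD eD sH kH HA).
  have [HB | HB] := eqVneq (vertices H :&: B) set0.
    by rewrite (completing_del noD eD sH kH HB) orbT.
  case/andP: sH => /= sHV sHA.
  (* As [e] does not go from [B] to [A], the cut of [D] is still one in [D + e]; it would separate
     [H] by at most [k - 1] vertices. *)
  have : kappa H <= #|vertices H :\: (A :|: B)|.
    apply: (kappa_le_cut disAB HA HB) => u v uB vA.
    apply/negP=> /(subsetP sHA); rewrite !inE (negPf (noBA _ _ uB vA)) orbF.
    by case/andP=> /eqP euv; rewrite -euv !inE uB vA in eBA.
  have := subset_leq_card (setSD (A :|: B) sHV).
  rewrite [leqRHS]cardsD (setIidPr _) ?subUset ?sA // cardsU (disjoint_setI0 disAB) cards0.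
  by move: kH cAB; rewrite /k_strongly_connected; clear -k_gt0; lia.
apply: leq_trans (subset_leq_card sub) _.
have cA : #|vertices (del_vertices D A)| = #|vertices D| - #|A|.
  by rewrite cardsD (setIidPr sA).
have cB : #|vertices (del_vertices D B)| = #|vertices D| - #|B|.
  by rewrite cardsD (setIidPr sB).
rewrite -card_gt0 in A0; rewrite -card_gt0 in B0.
have := IHn _ _ (has_k_strong_del A noD); have := IHn _ _ (has_k_strong_del B noD).
rewrite cA cB => /(_ ltac:(lia)) leB /(_ ltac:(lia)) leA.
apply: leq_trans (leq_card_setU _ _) _.
apply: leq_trans (leq_add (leqnn _) (leq_card_setU _ _)) _.
rewrite cardsX.
(* With [k - 1] vertices outside [A] and [B], deleting [A] turns the inductive bound into
   ['C(#|B|, 2)], and symmetrically for [B]. *)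
have -> : #|vertices D| - k + 1 = #|B| + #|A| by lia.
have eB : #|vertices D| - #|A| - k + 1 = #|B| by lia.
have eA : #|vertices D| - #|B| - k + 1 = #|A| by lia.
by rewrite binD2; move: leA leB; rewrite eA eB; lia.
Qed.

(** * The extremal digraph *)

Lemma kappa_complete W : #|W| - 1 <= kappa (mk_digraph W setT).
Proof.
apply: leq_kappa => [|S /andP[/= sSW]]; first exact: leq_subr.
case/orP=> [/forall_inPn[u uWS /forall_inPn[v vWS]] | /eqP/=].
  (* What remains of a complete digraph is complete, so a separator can only leave one vertex. *)
  rewrite negb_imply => /andP[neq_uv]; case/negP; apply: connect1.
  move: uWS vWS; rewrite /arc_rel !inE /= => /andP[-> ->] /andP[-> ->].
  by rewrite neq_uv.
by rewrite cardsD (setIidPr sSW); have := subset_leq_card sSW; lia.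
Qed.

End Connectivity.

(* The first m vertices are joined both ways to everything; the others form a
   transitive tournament. *)
Definition join_tournament n m : digraph 'I_n :=
  mk_digraph setT [set e : 'I_n * 'I_n | (e.1 < e.2) || (e.2 < m)].

Lemma card_join_tournament_complement n m :
  #|arcs (complement (join_tournament n m))| = 'C(n - m, 2).
Proof.
(* Only the backward arcs of the tournament part are missing; they are counted by their tail. *)
have -> : arcs (complement (join_tournament n m)) =
    [set e : 'I_n * 'I_n | m <= e.2 < e.1].
  apply/setP=> -[i j]; rewrite !inE /= -(inj_eq val_inj) /=; lia.
rewrite -sum1dep_card -(pair_big_dep xpredT (fun i j : 'I_n => m <= j < i)
  (fun _ _ => 1)) /=.
rewrite -sum_subn_bin2; apply: eq_bigr => i _.
by rewrite sum1dep_card card_ord_interval // ltnW.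
Qed.

Lemma join_tournament_saturated n k : 0 < k <= n ->
  saturated (k_strongly_connected k) (join_tournament n (k - 1)).
Proof.
case/andP=> k_gt0 le_kn; set m := k - 1.
(* The vacuous bound [0 <= i] gives [L] the form of an interval. *)
pose L := [set i : 'I_n | 0 <= i < m].
have cL : #|L| = m.
  by rewrite card_ord_interval ?subn0 // /m; lia.
split=> [[H /andP[/= _ sHA]] | [i j]].
  rewrite /k_strongly_connected => kH.
  have ltkH := leq_ltn_trans kH (kappa_lt_order (leq_trans k_gt0 kH)).
  (* [H] has at least [k + 1] vertices and [L] only [k - 1]. *)
  have : 1 < #|vertices H :\: L|.
    rewrite cardsD.
    have := subset_leq_card (subsetIr (vertices H) L).
    by rewrite cL /m; clear -ltkH k_gt0; lia.
  case/card_gt1P=> x [y []]; rewrite !inE /= -!leqNgt => /andP[le_mx xH] /andP[le_my yH].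
  wlog lt_xy : x y le_mx xH le_my yH / x < y => [wlog_xy | _].
    rewrite -(inj_eq val_inj) neq_ltn => /orP[lt_xy | lt_yx].
      by apply: (wlog_xy x y) => //; rewrite -(inj_eq val_inj) neq_ltn lt_xy.
    by apply: (wlog_xy y x) => //; rewrite -(inj_eq val_inj) neq_ltn lt_yx.
  (* The tournament is cut just before [y]: no arc goes back from [B] to [A], and only [L] lies
     outside them. *)
  pose A := [set z : 'I_n | m <= z < y]; pose B := [set z : 'I_n | (m <= z) && (y <= z)].
  have : kappa H <= #|vertices H :\: (A :|: B)|.
    apply: kappa_le_cut.
    - by rewrite -setI_eq0; apply/eqP/setP=> z; rewrite !inE; lia.
    - by apply/set0Pn; exists x; rewrite !inE xH le_mx.
    - by apply/set0Pn; exists y; rewrite !inE yH le_my leqnn.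
    move=> u v; rewrite !inE => uB vA; apply/negP=> /(subsetP sHA).
    by rewrite !inE /=; lia.
  apply/negP; rewrite -ltnNge; apply: leq_trans kH.
  suff: #|vertices H :\: (A :|: B)| <= m by rewrite /m; lia.
  rewrite -[leqRHS]cL; apply/subset_leq_card/subsetP=> z; rewrite !inE; lia.
rewrite !inE /= -(inj_eq val_inj) /= => ij.
(* The arc from [j] to [i] is present, and [L] is joined both ways to everything, so adding the arc
   from [i] to [j] makes these [k + 1] vertices a complete digraph. *)
pose W := L :|: [set i; j].
exists (mk_digraph W setT).
  rewrite /subdigraph subsetT; apply/subsetP=> -[x y]; rewrite !inE /=.
  by rewrite xpair_eqE -!(inj_eq val_inj) /=; lia.
apply: leq_trans (kappa_complete W).
rewrite cardsU cL cards2 (_ : _ :&: _ = set0) ?cards0; last first.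
  by apply/setP=> z; rewrite !inE -!(inj_eq val_inj) /=; lia.
by rewrite -(inj_eq val_inj) /= /m; lia.
Qed.

(** The claimed value is the number of all possible arcs minus the maximal number of completing
    ones, stated additively to avoid truncated subtraction. *)
Lemma saturation_arith n k : 1 <= k -> k <= n ->
  'C(n - k + 1, 2) + (k - 1) * (2 * n - k) + 'C(n - k + 1, 2) = n * (n - 1).
Proof.
case: k => // m _ /subnKC <-; set d := n - m.+1.
(* This is [d.+1 * d = 2 * 'C(d.+1, 2)], which removes the binomials. *)
have := mul_bin_diag d.+1 1; rewrite bin1 addKn addn1 => eC.
have -> : 2 * (m.+1 + d) - m.+1 = m + 1 + 2 * d by lia.
rewrite addSn !subn1 /= addnAC addnn -mul2n -eC.
by move: d {eC} => d; lia.
Qed.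

Theorem theorem3p9 (k n : nat) (hk : 1 <= k) (hn : k <= n) :
  is_sat n (k_strongly_connected k)
    ('C(n - k + 1, 2) + (k - 1) * (2 * n - k)).
Proof.
have arith := saturation_arith hk hn.
split=> [|T D cD [noD satD]].
  exists 'I_n, (join_tournament n (k - 1)); split.
  - by rewrite cardsT card_ord.
  - by apply: join_tournament_saturated; rewrite hk.
  have := card_complement (join_tournament n (k - 1)).
  rewrite card_join_tournament_complement cardsT card_ord.
  by rewrite (_ : n - (k - 1) = n - k + 1); lia.
have /negP noD' : ~ has_k_strong k D by move/has_k_strongP.
have := card_completing_arcs hk noD'.
have -> : completing_arcs k D = arcs (complement D).
  apply/setP=> e; rewrite in_set andb_idr // => eD.
  by apply/has_k_strongP/satD.
by have := card_complement D; rewrite cD; lia.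
Qed.
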